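(* Consider the following $510$ pairs of circulant graphs of order $32$, indexed by the nonempty subsets $E$ of $\{2,4,6,8,10,12,14,16\}$ ($255$ pairs in each family): (a) $C_{32}(\{1,15\}\cup E)$ and $C_{32}(\{7,9\}\cup E)$; (b) $C_{32}(\{3,13\}\cup E)$ and $C_{32}(\{5,11\}\cup E)$. Then the two graphs in each of these $510$ pairs are isomorphic, each pair is either Type-1 isomorphic or Type-2 isomorphic with respect to $m=2$, and the number of these pairs that are Type-2 isomorphic with respect to $m=2$ is exactly $384$.
   Context: For $n\ge 2$ and $R\subseteq\{1,\dots,\lfloor n/2\rfloor\}$, the circulant graph $C_n(R)$ has vertices $v_0,\dots,v_{n-1}$ (subscripts mod $n$), with $v_x$ adjacent to $v_{x+s}$ and $v_{x-s}$ for every $x\in\mathbb{Z}_n$ and $s\in R$; $C_n(r_1,\dots,r_k)$ means $C_n(\{r_1,\dots,r_k\})$. Reflexive reduction modulo $n$: each integer is reduced modulo $n$ to an element $r'$ of $\{0,\dots,n-1\}$, and $r'$ is replaced by $n-r'$ if $r'>n/2$. For an integer $y$ coprime to $n$, $yR$ denotes the set of reflexive reductions modulo $n$ of $yr$, $r\in R$. Type-1 (Adam's) isomorphism: $C_n(R)$ and $C_n(S)$ are Type-1 isomorphic if $S=yR$ for some positive integer $y$ with $\gcd(n,y)=1$. Type-2 isomorphism: let $|R|\ge 3$, $r\in R$, and let $m>1$ be such that $m$ divides $\gcd(n,r)$ and $m^3$ divides $n$. For $0\le t\le \frac{n}{m}-1$ let $\theta_{n,m,t}$ be the injective map sending $v_x$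 to $u_{x+jtm}$ (subscripts mod $n$), where $u_0,\dots,u_{n-1}$ are the vertices of $K_n$ and $x=qm+j$ with $0\le j\le m-1$, $0\le q\le \frac nm-1$; an edge $(v_x,v_{x+s})$ is sent to $(\theta_{n,m,t}(v_x),\theta_{n,m,t}(v_{x+s}))$, and $\theta_{n,m,t}(C_n(R))$ is the resulting image graph on $u_0,\dots,u_{n-1}$. We write $\theta_{n,m,t}(C_n(R))=C_n(S)$ if this image graph is the circulant graph with jump set $S$ on $u_0,\dots,u_{n-1}$ (with $u_i$ in the role of $v_i$). The graphs $C_n(R)$ and $C_n(S)$ are Type-2 isomorphic with respect to $m$ if $\theta_{n,m,t}(C_n(R))=C_n(S)$ for some such $t$ and $S\ne yR$ for every $y$ coprime to $n$. *)

(* Defs.v *)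
From HB Require Import structures.
From mathcomp Require Import all_boot all_order all_algebra.
From mathcomp Require Import finmap.
From mathcomp Require Import boolp.

Set Implicit Arguments.
Unset Strict Implicit.
Unset Printing Implicit Defensive.

Import GRing.Theory.
Local Open Scope fset_scope.

(* A graph on the n vertices v_0, ..., v_(n-1) is its adjacency relation on the
   indices 'Z_n.  Throughout, n >= 2, so that 'Z_n is Z/nZ, and jump sets are
   finite subsets of {1, ..., n./2}. *)

Definition circulant (n : nat) (R : {fset nat}) : rel 'Z_n :=
  fun x y => [exists s : R,
    (y == x + (val s)%:R)%R || (y == x - (val s)%:R)%R].

Definition graph_isomorphic (n : nat) (e1 e2 : rel 'Z_n) : Prop :=
  exists2 f : 'Z_n -> 'Z_n, bijective f & forall x y, e1 x y = e2 (f x) (f y).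

Definition image_graph (n : nat) (f : 'Z_n -> 'Z_n) (e : rel 'Z_n) : rel 'Z_n :=
  fun u w => [exists x, exists y, [&& e x y, f x == u & f y == w]].

Definition reflexive_reduction (n : nat) (z : int) : nat :=
  let r := `|(z %% n)%Z|%N in if n < r.*2 then n - r else r.

Definition scale_jumps (n : nat) (y : int) (R : {fset nat}) : {fset nat} :=
  [fset reflexive_reduction n (y * r%:Z)%R | r in R].

Definition type1_isomorphic (n : nat) (R S : {fset nat}) : Prop :=
  exists y : nat, [/\ 0 < y, gcdn n y = 1 & S = scale_jumps n y R].

(* x = q * m + j with 0 <= j < m, so that j = x %% m. *)
Definition theta (n m t : nat) (x : 'Z_n) : 'Z_n :=
  (x + ((x %% m) * t * m)%N%:R)%R.

Definition type2_isomorphic (n m : nat) (R S : {fset nat}) : Prop :=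
  [/\ 3 <= #|` R|,
      [/\ 1 < m, m ^ 3 %| n & exists2 r, r \in R & m %| gcdn n r],
      exists2 t, t <= n %/ m - 1 &
        image_graph (@theta n m t) (circulant R) =2 circulant S
    & forall y : int, coprimez n y -> S <> scale_jumps n y R].

Definition even_jump_sets : {fset {fset nat}} :=
  fpowerset [fset 2; 4; 6; 8; 10; 12; 14; 16] `\ fset0.

Definition family_a : {fset {fset nat} * {fset nat}} :=
  [fset ([fset 1; 15] `|` E, [fset 7; 9] `|` E) | E in even_jump_sets].

Definition family_b : {fset {fset nat} * {fset nat}} :=
  [fset ([fset 3; 13] `|` E, [fset 5; 11] `|` E) | E in even_jump_sets].

(* Main.v *)
(** Call an even set E balanced when it is stable under 2 <-> 14 and 6 <-> 10.
    Since theta(32,2,4) shifts the odd vertices by 8, it changes y - x by 8 or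
    -8 when y - x is odd and preserves it when y - x is even; hence it exchanges
    the odd jumps {1,15} and {7,9}, also {3,13} and {5,11}, and fixes every even
    jump.  So theta carries the first graph of each pair onto the second.  A unit
    carrying the odd jumps of the first graph to those of the second is 7, 9, -7
    or -9 modulo 32; each of them acts on the even jumps by the swaps 2 <-> 14 and
    6 <-> 10.  So a pair is Type-1 when E is balanced and Type-2 otherwise.  A
    balanced E is determined by a subset of {2,4,6,8,12,16}, so each family has
    2^8 - 2^6 = 192 pairs of Type-2. *)

Require Import Defs.
From mathcomp Require Import all_boot all_order all_algebra.
From mathcomp Require Import finmap.
From mathcomp Require Import boolp.

Set Implicit Arguments.
Unset Strict Implicit.
Unset Printing Implicit Defensive.

Local Open Scope fset_scope.

(** * Adjacency along a single jump, and images of graphs *)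

Definition adjacent_by (s : nat) (x y : 'Z_32) : bool :=
  ((y == x + s%:R) || (y == x - s%:R))%R.

Lemma circulantP (R : {fset nat}) (x y : 'Z_32) :
  reflect (exists2 s, s \in R & adjacent_by s x y) (@circulant 32 R x y).
Proof.
apply: (iffP existsP) => [[s xy]|[s sR xy]]; last by exists [` sR].
by exists (val s); first exact: valP.
Qed.

Lemma image_graph_bij (n : nat) (f : 'Z_n -> 'Z_n) (e1 e2 : rel 'Z_n) :
  bijective f -> (forall x y, e1 x y = e2 (f x) (f y)) ->
  image_graph f e1 =2 e2.
Proof.
move=> [g fK gK] e12 u w; apply/existsP/idP => [[x /existsP[y]]|uw].
  by move=> /and3P[xy /eqP<- /eqP<-]; rewrite -e12.
exists (g u); apply/existsP; exists (g w).
by rewrite e12 !gK uw !eqxx.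
Qed.

Definition even_jumps : seq nat := [:: 2; 4; 6; 8; 10; 12; 14; 16].

(** The odd jumps of both graphs of a pair, for family (a) and then (b). With [p] as a parameter
    each lemma serves both families, and as concrete data it can be checked by computation. *)
Definition jump_pairs : seq ((nat * nat) * (nat * nat)) :=
  [:: ((1, 15), (7, 9)); ((3, 13), (5, 11))].

Lemma even_jump_notin p e : p \in jump_pairs -> e \in even_jumps ->
  (e \notin [:: p.1.1; p.1.2]) && (e \notin [:: p.2.1; p.2.2]).
Proof.
have /allP chk : all (fun p => all (fun e =>
    (e \notin [:: p.1.1; p.1.2]) && (e \notin [:: p.2.1; p.2.2])) even_jumps)
  jump_pairs by vm_compute.
by move=> /chk/allP; apply.
Qed.

(** * The map theta(32,2,4) and its effect on jumps *)

Definition twist : 'Z_32 -> 'Z_32 := @theta 32 2 4.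

Lemma forall_Z32 (P : pred 'Z_32) :
  all (fun i => P (inZp i)) (iota 0 32) -> forall x, P x.
Proof.
by move=> /allP allP x; rewrite -[x]valZpK; apply: allP; rewrite mem_iota /= ltn_ord.
Qed.

(** [twist] adds 8 to odd vertices, which stay odd, and fixes even ones; four rounds add 32 or 0. *)
Lemma twist4 : cancel twist (twist \o twist \o twist).
Proof.
move=> x; apply/eqP; move: x; apply: forall_Z32; vm_compute; reflexivity.
Qed.

Lemma twist_bij : bijective twist.
Proof. by exists (twist \o twist \o twist) => x; exact: twist4. Qed.

Lemma twist_even_jump (s : nat) (x y : 'Z_32) :
  s \in even_jumps -> adjacent_by s x y -> adjacent_by s (twist x) (twist y).
Proof.
have chk : forall x, all (fun s =>
    adjacent_by s (twist x) (twist (x + s%:R)%R) &&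
    adjacent_by s (twist x) (twist (x - s%:R)%R)) even_jumps.
  by apply: forall_Z32; vm_compute.
by move=> s_ev; move: (chk x) => /allP/(_ s s_ev)/andP[? ?] /orP[]/eqP->.
Qed.

(** Both directions are kept because the inverse of [twist] is obtained by iterating it, which
    exchanges the odd jumps back and forth. *)
Definition opposite_pairs := jump_pairs ++ [seq (p.2, p.1) | p <- jump_pairs].

(** Exactly one end of such an edge is odd and moves by 8. Which of the two new jumps results
    depends on which end that is, hence the [has]. *)
Lemma twist_odd_jump p (s : nat) (x y : 'Z_32) :
  p \in opposite_pairs -> s \in [:: p.1.1; p.1.2] -> adjacent_by s x y ->
  has (fun s' => adjacent_by s' (twist x) (twist y)) [:: p.2.1; p.2.2].
Proof.
have chk : forall x, all (fun p => all (fun s =>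
    has (fun s' => adjacent_by s' (twist x) (twist (x + s%:R)%R))
      [:: p.2.1; p.2.2] &&
    has (fun s' => adjacent_by s' (twist x) (twist (x - s%:R)%R))
      [:: p.2.1; p.2.2]) [:: p.1.1; p.1.2]) opposite_pairs.
  by apply: forall_Z32; vm_compute.
move=> p_op s_p; move: (chk x) => /allP/(_ p p_op)/allP/(_ s s_p)/andP[? ?].
by move=> /orP[]/eqP->.
Qed.

Definition with_evens (o : nat * nat) (E : {fset nat}) : {fset nat} :=
  [fset o.1; o.2] `|` E.

Lemma in_with_evens o E s :
  (s \in with_evens o E) = (s \in [:: o.1; o.2]) || (s \in E).
Proof. by rewrite !inE. Qed.

Lemma even_jump_setsE (E : {fset nat}) :
  (E \in even_jump_sets) = (E != fset0) && (E `<=` [fset x in even_jumps]).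
Proof.
rewrite !inE fpowersetE; congr (_ && (_ `<=` _)).
by apply/fsetP => x; rewrite !inE -!orbA orbF.
Qed.

Lemma even_jump_setsP {E : {fset nat}} :
  E \in even_jump_sets -> {subset E <= even_jumps}.
Proof.
by rewrite even_jump_setsE => /andP[_ /fsubsetP sub] e /sub; rewrite in_fset.
Qed.

Lemma twist_edge p E (x y : 'Z_32) :
  p \in opposite_pairs -> E \in even_jump_sets ->
  circulant (with_evens p.1 E) x y ->
  circulant (with_evens p.2 E) (twist x) (twist y).
Proof.
move=> p_op /even_jump_setsP evE /circulantP[s].
rewrite in_with_evens => /orP[sp|sE] xy; apply/circulantP.
  have /hasP[s' s'p xy'] := twist_odd_jump p_op sp xy.
  by exists s'; rewrite // in_with_evens s'p.
by exists s; [rewrite in_with_evens sE orbT | exact: twist_even_jump (evE _ sE) xy].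
Qed.

Lemma twist_circulant p E (x y : 'Z_32) :
  p \in jump_pairs -> E \in even_jump_sets ->
  circulant (with_evens p.1 E) x y =
  circulant (with_evens p.2 E) (twist x) (twist y).
Proof.
move=> pJ evE.
have p_op : p \in opposite_pairs by rewrite mem_cat pJ.
have p_op' : (p.2, p.1) \in opposite_pairs.
  by rewrite mem_cat orbC; apply/orP; left; apply/mapP; exists p.
apply/idP/idP => [|xy]; first exact: twist_edge.
(* The vertices become cubes of [twist] applied to [twist x] and [twist y]; three applications, an
   odd number, turn the odd jumps [p.2] back into [p.1]. *)
rewrite -[x]twist4 -[y]twist4 /=.
by apply: (twist_edge p_op' evE); apply: (twist_edge p_op evE);
  apply: (twist_edge p_op' evE).
Qed.

(** * Scaling by units and balanced even sets *)

Definition balanced (E : {fset nat}) : bool :=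
  ((2 \in E) == (14 \in E)) && ((6 \in E) == (10 \in E)).

(** One unit serves both families: 7 sends 1, 15 to 7, 9 and 3, 13 to 11, 5. *)
Definition times7 (r : nat) : nat := reflexive_reduction 32 (7%:Z * r%:Z)%R.

(* Times 7 is an involution only on even jumps: 7 ^ 2 = 17 modulo 32. *)
Lemma times7K e : e \in even_jumps -> times7 (times7 e) = e.
Proof.
have /allP chk : all (fun e => times7 (times7 e) == e) even_jumps by vm_compute.
by move=> /chk/eqP.
Qed.

Lemma times7_even e : e \in even_jumps -> times7 e \in even_jumps.
Proof. by move: e; apply/allP; vm_compute. Qed.

(** On even jumps, 7 fixes 4, 8, 12, 16 and swaps 2 with 14 and 6 with 10. *)
Lemma balanced_times7 E e :
  E \in even_jump_sets -> balanced E -> e \in E -> times7 e \in E.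
Proof.
move=> /even_jump_setsP evE /andP[/eqP E2 /eqP E6] eE.
have /allP chk : all (fun e => (times7 e == e) ||
    ((e, times7 e) \in [:: (2, 14); (14, 2); (6, 10); (10, 6)])) even_jumps.
  by vm_compute.
have /predU1P[->//|] := chk e (evE e eE); rewrite !inE.
by move=> /or4P[] /eqP[ee ->]; move: eE; rewrite ee ?E2 ?E6.
Qed.

Lemma mem_scale_jumps n (y : int) (R : {fset nat}) r :
  r \in R -> reflexive_reduction n (y * r%:Z)%R \in scale_jumps n y R.
Proof. by move=> rR; apply/imfsetP; exists r. Qed.

Lemma balanced_scale p E : p \in jump_pairs -> E \in even_jump_sets ->
  balanced E -> with_evens p.2 E = scale_jumps 32 7 (with_evens p.1 E).
Proof.
move=> pJ evE balE; have evE' := even_jump_setsP evE.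
have /perm_mem pT : perm_eq [seq times7 s | s <- [:: p.1.1; p.1.2]]
    [:: p.2.1; p.2.2].
  by move: pJ; rewrite !inE => /orP[]/eqP->; vm_compute.
apply/fsetP => z; apply/idP/imfsetP => [|[r /= rR ->]].
  rewrite in_with_evens => /orP[]; last first.
    move=> zE; exists (times7 z); last by rewrite -/(times7 _) times7K ?evE'.
    by rewrite /= in_with_evens balanced_times7 ?orbT.
  by rewrite -pT => /mapP[s sp ->]; exists s; rewrite //= in_with_evens sp.
move: rR; rewrite !in_with_evens => /orP[rp|rE]; apply/orP; [left|right].
  by rewrite -pT -/(times7 r) map_f.
exact: balanced_times7.
Qed.

(** Replacing an integer multiplier by its residue leaves only 32 cases to compute. *)
Lemma reflexive_reductionM (y : int) r :
  reflexive_reduction 32 (y * r%:Z)%R =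
  reflexive_reduction 32 (`|(y %% 32)%Z|%N%:Z * r%:Z)%R.
Proof. by rewrite /reflexive_reduction gez0_abs ?modz_ge0 // modzMml. Qed.

Lemma scale_balanced p E (y : int) : p \in jump_pairs -> E \in even_jump_sets ->
  coprimez 32 y -> with_evens p.2 E = scale_jumps 32 y (with_evens p.1 E) ->
  balanced E.
Proof.
move=> pJ evE co eqS; have evE' := even_jump_setsP evE.
pose k := `|(y %% 32)%Z|%N.
have k32 : k < 32 by rewrite -ltz_nat gez0_abs ?modz_ge0 // ltz_pmod.
have cok : coprime 32 k.
  by move: co; rewrite /coprimez -gcdz_modr /gcdz /coprime -/k.
have scaled r : r \in with_evens p.1 E ->
    reflexive_reduction 32 (k%:Z * r%:Z)%R \in with_evens p.2 E.
  by move=> rR; rewrite eqS -reflexive_reductionM mem_scale_jumps.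
(* The image of one odd jump already forces [k] to be 7, 9, -7 or -9 modulo 32. The even values are
   listed because [E] is unknown; a unit times an odd jump is odd, so they never occur. *)
have chk : all (fun k => all (fun p => coprime 32 k ==>
    (reflexive_reduction 32 (k%:Z * p.1.1%:Z)%R \in [:: p.2.1; p.2.2] ++ even_jumps) ==>
    all (fun e => reflexive_reduction 32 (k%:Z * e%:Z)%R == times7 e) even_jumps)
    jump_pairs) (iota 0 32) by vm_compute.
have p11 : reflexive_reduction 32 (k%:Z * p.1.1%:Z)%R \in [:: p.2.1; p.2.2] ++ even_jumps.
  have := scaled p.1.1; rewrite !in_with_evens mem_head mem_cat => /(_ isT).
  by case/orP => [->//|/evE' ->]; rewrite orbT.
have kT : {in even_jumps, forall e, reflexive_reduction 32 (k%:Z * e%:Z)%R = times7 e}.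
  move: chk => /allP/(_ k); rewrite mem_iota k32 => /(_ isT)/allP/(_ p pJ).
  by rewrite cok p11 => /allP kT e /kT/eqP.
(* The image of an even jump is even, so it cannot be one of the odd jumps and must lie in [E]. *)
have stable e : e \in E -> times7 e \in E.
  move=> eE; have ev := evE' _ eE.
  have := scaled e; rewrite kT // !in_with_evens eE orbT => /(_ isT)/orP[|//].
  have /andP[_ /negbTE->] // := even_jump_notin pJ (times7_even ev).
by apply/andP; split; apply/eqP; apply/idP/idP => /stable.
Qed.

Lemma type1_balanced p E : p \in jump_pairs -> E \in even_jump_sets ->
  balanced E -> type1_isomorphic 32 (with_evens p.1 E) (with_evens p.2 E).
Proof. by move=> pJ evE balE; exists 7; split; rewrite // -balanced_scale. Qed.

(** The [theta] clause holds for every [E], so only the absence of a scaling decides, and a scaling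
    exists exactly when [E] is balanced. *)
Lemma type2_balanced p E : p \in jump_pairs -> E \in even_jump_sets ->
  `[< type2_isomorphic 32 2 (with_evens p.1 E) (with_evens p.2 E) >] =
  ~~ balanced E.
Proof.
move=> pJ evE; apply/asboolP/idP => [[_ _ _ noscale]|nbal].
  by apply/negP => balE; apply: (noscale (Posz 7)) => //; exact: balanced_scale.
have evE' := even_jump_setsP evE.
(* Such an [e] serves twice: it is the third jump besides the two odd ones, and it is the jump
   divisible by [m = 2]. *)
have [e eE] : exists e, e \in E.
  by apply/fset0Pn; move: evE; rewrite even_jump_setsE => /andP[].
have ev := evE' _ eE.
split.
- apply: leq_trans (fsubset_leq_card (_ : [fset p.1.1; p.1.2; e] `<=` _)).
    have /andP[e1 _] := even_jump_notin pJ ev.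
    move: e1; rewrite fsetUC cardfsU1 cardfs2 !inE => ->.
    by move: pJ; rewrite !inE => /orP[]/eqP->.
  by apply/fsubsetP => s; rewrite !inE -orbA => /or3P[]/eqP->; rewrite ?eqxx ?eE ?orbT.
- split=> //; exists e; first by rewrite in_with_evens eE orbT.
  by move: e {eE} ev; apply/allP; vm_compute.
- exists 4 => //; apply: image_graph_bij; first exact: twist_bij.
  by move=> x y; exact: twist_circulant.
- by move=> y co eqS; case/negP: nbal; exact: scale_balanced eqS.
Qed.

(** * Counting balanced and unbalanced even sets *)

Lemma card_fpowerset (K : choiceType) (A : {fset K}) :
  #|` fpowerset A| = 2 ^ #|` A|.
Proof.
(* Subsets of [A] are carried over from sets on the finite type of its elements, where the power set
   has known size. *)
pose B : {fset {set A}} := [fset Y in powerset [set: A]].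
have -> : fpowerset A = [fset [fsetval y in (Y : {set A})] | Y in B].
  apply/fsetP => C; rewrite fpowersetE; apply/fsubsetP/imfsetP => /=.
    move=> /fsubsetP CA; exists (fsub A C); last by rewrite fsubK.
    by rewrite !inE subsetT.
  by move=> [Y _ ->] z /in_fset_valP[].
rewrite card_in_imfset /=; last first.
  move=> Y Z _ _ /fsetP YZ; apply/setP => y.
  by have := YZ (val y); rewrite !val_in_fset.
by rewrite card_finset card_powerset cardsT cardfE.
Qed.

(** Each comprehension is a singleton or empty according to its condition. On subsets of
    [free_jumps] this inverts the restriction of balanced sets to [free_jumps]. *)
Definition add_partners (D : {fset nat}) : {fset nat} :=
  D `|` [fset x in [:: 14] | 2 \in D] `|` [fset x in [:: 10] | 6 \in D].

Lemma in_add_partners D z : (z \in add_partners D) =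
  [|| z \in D, (z == 14) && (2 \in D) | (z == 10) && (6 \in D)].
Proof. by rewrite !inE -orbA. Qed.

Definition free_jumps : {fset nat} := [fset x in [:: 2; 4; 6; 8; 12; 16]].

(** Balanced sets correspond to the 2^6 subsets of [free_jumps]; the empty set is counted here. *)
Lemma card_balanced :
  #|` [fset E in fpowerset [fset x in even_jumps] | balanced E]| = 64.
Proof.
have -> : [fset E in fpowerset [fset x in even_jumps] | balanced E] =
    [fset add_partners D | D in fpowerset free_jumps].
  apply/fsetP => E; rewrite !inE fpowersetE; apply/andP/imfsetP => /=.
    move=> [/fsubsetP evE /andP[/eqP E2 /eqP E6]].
    exists (E `&` free_jumps); first by rewrite fpowersetE fsubsetIr.
    apply/fsetP => z; rewrite in_add_partners !inE /= !andbT.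
    case: (altP (z =P 14)) => [->|z14]; first by rewrite E2 andbF orbF.
    case: (altP (z =P 10)) => [->|z10]; first by rewrite E6 andbF.
    rewrite !orbF; case zE: (z \in E) => //=.
    by have := evE _ zE; rewrite !inE (negbTE z14) (negbTE z10) /= orbF => ->.
  move=> [D]; rewrite fpowersetE => /fsubsetP subD ->.
  have n14 : 14 \in D = false by apply/negP => /subD; rewrite !inE.
  have n10 : 10 \in D = false by apply/negP => /subD; rewrite !inE.
  split; last by rewrite /balanced !in_add_partners /= n14 n10 !orbF !eqxx.
  apply/fsubsetP => z; rewrite in_add_partners in_fset.
  case/or3P => [/subD|/andP[/eqP-> _]|/andP[/eqP-> _]] //.
  by rewrite in_fset; move: z; apply/allP.
rewrite card_in_imfset /=; last first.
  move=> D D'; rewrite !fpowersetE => /fsubsetP sD /fsubsetP sD' eqD.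
  have restr C : {subset C <= free_jumps} -> C = add_partners C `&` free_jumps.
    move=> sC; apply/fsetP => z; rewrite inE in_add_partners.
    case: (boolP (z \in C)) => [/sC->//|_] /=.
    by case: eqP => [->|_]; case: eqP => [->|_]; rewrite ?andbF //= ?inE ?andbF.
  by rewrite (restr D sD) eqD -restr.
by rewrite card_fpowerset card_fseq.
Qed.

Lemma even_jump_sets_D1 :
  even_jump_sets = fpowerset [fset x in even_jumps] `\ fset0.
Proof. by apply/fsetP => E; rewrite even_jump_setsE in_fsetD1 fpowersetE. Qed.

Lemma card_even_jump_sets : #|` even_jump_sets| = 255.
Proof.
have := cardfsD1 fset0 (fpowerset [fset x in even_jumps]).
by rewrite -even_jump_sets_D1 card_fpowerset card_fseq fpowersetE fsub0set => -[].
Qed.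

Lemma card_unbalanced : #|` [fset E in even_jump_sets | ~~ balanced E]| = 192.
Proof.
have := cardfsID [fset E in fpowerset [fset x in even_jumps] | balanced E]
                 (fpowerset [fset x in even_jumps]).
rewrite (fsetIidPr _) ?fset_sub // card_balanced card_fpowerset card_fseq.
have -> : fpowerset [fset x in even_jumps] `\`
   [fset E in fpowerset [fset x in even_jumps] | balanced E] =
   [fset E in even_jump_sets | ~~ balanced E].
  apply/fsetP => E; rewrite even_jump_sets_D1 !inE fpowersetE.
  (* The empty set is balanced, so excluding it does not change the number of unbalanced sets: 256 -
     64. *)
  case: (altP (E =P fset0)) => [->|_] /=; last by case: (_ `<=` _); rewrite //= andbT.
  by rewrite fsub0set /balanced !inE.
by move=> /eqP; rewrite -[_ ^ _]/(64 + 192)%N eqn_add2l => /eqP.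
Qed.

(** * Counting pairs in the two families *)

Definition family (p : (nat * nat) * (nat * nat)) :=
  [fset (with_evens p.1 E, with_evens p.2 E) | E in even_jump_sets].

(** [E] is recovered as the even part of the first jump set. *)
Lemma family_inj p : p \in jump_pairs ->
  {in even_jump_sets &,
    injective (fun E => (with_evens p.1 E, with_evens p.2 E))}.
Proof.
move=> pJ E E' /even_jump_setsP evE /even_jump_setsP evE' [/fsetP eq1 _].
apply/fsetP => s; case: (boolP (s \in even_jumps)) => [sev|/negP sev]; last first.
  by apply/idP/idP => [/evE|/evE'].
have := eq1 s; rewrite !in_with_evens.
by have /andP[/negbTE-> _] := even_jump_notin pJ sev.
Qed.

Lemma card_family p : p \in jump_pairs -> #|` family p| = 255.
Proof.
by move=> pJ; rewrite card_in_imfset ?card_even_jump_sets //; exact: family_inj.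
Qed.

Lemma card_family_type2 p : p \in jump_pairs ->
  #|` [fset q in family p | `[< type2_isomorphic 32 2 q.1 q.2 >]]| = 192.
Proof.
move=> pJ; rewrite -card_unbalanced.
have inU E : (E \in [fset E in even_jump_sets | ~~ balanced E]) =
    (E \in even_jump_sets) && ~~ balanced E by rewrite in_fset.
have -> : [fset q in family p | `[< type2_isomorphic 32 2 q.1 q.2 >]] =
  [fset (with_evens p.1 E, with_evens p.2 E)
     | E in [fset E in even_jump_sets | ~~ balanced E]].
  apply/fsetP => q; rewrite !inE; apply/andP/imfsetP => /=.
    move=> [/imfsetP[E /= evE ->]]; rewrite type2_balanced // => nb.
    by exists E; rewrite // inU evE.
  move=> [E]; rewrite inU => /andP[evE nb] ->; rewrite type2_balanced //.
  by split=> //; apply/imfsetP; exists E.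
rewrite card_in_imfset // => E E'; rewrite !inU => /andP[? _] /andP[? _].
exact: family_inj.
Qed.

Lemma family_disjoint :
  [disjoint family ((1, 15), (7, 9)) & family ((3, 13), (5, 11))].
Proof.
apply/fdisjointP => q /imfsetP[E /= evE ->]; apply/negP => /imfsetP[E' /= evE'].
(* Jump 1 lies in every first set of family (a) and in none of family (b). *)
case=> /fsetP/(_ 1) + _; rewrite !in_with_evens /= => /esym.
by move/(even_jump_setsP evE').
Qed.

Theorem mainTheorem1 :
  [/\ #|` family_a| = 255, #|` family_b| = 255 & #|` family_a `|` family_b| = 510] /\
  (forall R S : {fset nat}, (R, S) \in family_a `|` family_b ->
     graph_isomorphic (@circulant 32 R) (@circulant 32 S) /\
     (type1_isomorphic 32 R S \/ type2_isomorphic 32 2 R S)) /\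
  #|` [fset p in family_a `|` family_b | `[< type2_isomorphic 32 2 p.1 p.2 >]]| = 384.
Proof.
have aE : family_a = family ((1, 15), (7, 9)) by [].
have bE : family_b = family ((3, 13), (5, 11)) by [].
have aJ : ((1, 15), (7, 9)) \in jump_pairs by [].
have bJ : ((3, 13), (5, 11)) \in jump_pairs by [].
have /fdisjointP disj := family_disjoint.
(* Stated for subsets of the families so that it gives both the total 255 + 255 and the Type-2 count
   192 + 192. *)
have cardU (A B : {fset {fset nat} * {fset nat}}) : A `<=` family_a -> B `<=` family_b ->
    #|` A `|` B| = (#|` A| + #|` B|)%N.
  move=> /fsubsetP sA /fsubsetP sB; rewrite -cardfsUI; apply/esym/eqP.
  rewrite -{2}[#|` A `|` B|]addn0 eqn_add2l cardfs_eq0 fsetI_eq0.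
  by apply/fdisjointP => q /sA/disj; apply: contra => /sB.
split; first by split; rewrite ?cardU // ?aE ?bE !card_family.
split=> [R S|].
  rewrite in_fsetU aE bE.
  have inF p : p \in jump_pairs -> (R, S) \in family p ->
      graph_isomorphic (@circulant 32 R) (@circulant 32 S) /\
      (type1_isomorphic 32 R S \/ type2_isomorphic 32 2 R S).
    move=> pJ /imfsetP[E /= evE [-> ->]]; split.
      by exists twist; [exact: twist_bij | move=> x y; exact: twist_circulant].
    case balE: (balanced E); first by left; exact: type1_balanced.
    by right; apply/asboolP; rewrite type2_balanced // balE.
  by case/orP; exact: inF.
have -> (P : pred ({fset nat} * {fset nat})) : [fset q in family_a `|` family_b | P q] =
    [fset q in family_a | P q] `|` [fset q in family_b | P q].
  by apply/fsetP => q; rewrite !inE andb_orl.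
by rewrite cardU ?fset_sub // aE bE !card_family_type2.
Qed.
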